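(* Let $\mathcal{A}$ be a nonempty closed convex subset of a finite-dimensional normed space, let $\mathscr{L}$ be a space of loss functions on $\Theta\times\mathcal{A}$, and for a fixed decision problem let $B_L(a)$ be the Bayes risk of action $a\in\mathcal{A}$ under $L\in\mathscr{L}$, with $\mathcal{O}(L)=\arg\min_{a\in\mathcal{A}}B_L(a)$ the (possibly empty) set of Bayes acts. Let $L_0,L_1\in\mathscr{L}$ and for $\alpha\in[0,1]$ put $L_\alpha:=(1-\alpha)L_0+\alpha L_1$. Assume: (i) $\mathscr{L}$ is convex, so $L_\alpha\in\mathscr{L}$ for all $\alpha\in[0,1]$; (ii) for every $\alpha\in[0,1]$ the functional $B_\alpha(a):=B_{L_\alpha}(a)=(1-\alpha)B_{L_0}(a)+\alpha B_{L_1}(a)$ is proper, lower semicontinuous, coercive and strictly convex in $a$; (iii) the map $(\alpha,a)\mapsto B_\alpha(a)$ is jointly continuous; (iv) the unique Bayes acts at the endpoints, $a_i^*:=\arg\min_aB_{L_i}(a)$ for $i=0,1$, are distinct: $a_0^*\ne a_1^*$. Let $a^*(\alpha)$ denote the unique minimizer of $B_\alpha$, so that $\mathcal{O}(L_\alpha)=\{a^*(\alpha)\}$ is single-valued. Then the set of Bayes acts $\{a^*(\alpha):\alpha\in[0,1]\}$ is uncountable (the map $\alpha\mapsto a^*(\alpha)$ need not be injective, and an exclusivity class may contain other losses sharing the same Bayes act). Consequently the segment $\{L_\alpha:\alpha\in[0,1]\}$ meets uncountably many pairwise distinct realizable exclusivity classes: covering the segment by realizable exclusivity classes requires uncountably many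 of them. Hence no finite family of realizable exclusivity classes is total on (i.e. covers) this convex segment.
   Context: A loss function is a measurable map $L:\Theta\times\mathcal{A}\to[0,\infty)$ such that $a\mapsto L(\theta,a)$ is continuous for each $\theta\in\Theta$. The Bayes risk of an action $a$ is the expected loss $B_L(a)=\mathbb{E}[L(\theta,a)]$ under the fixed distribution of $\theta$ of the decision problem. Estimators (decision rules) here are identified with actions $\delta\in\mathcal{A}$, and $\mathcal{O}$ is the optimality operator on $\mathscr{L}$. A subset $\mathcal{C}\subseteq\mathscr{L}$ is an exclusivity region (under $\mathcal{O}$) if no estimator $\delta$ belongs both to $\mathcal{O}(L)$ for some $L\in\mathcal{C}$ and to $\mathcal{O}(L')$ for some $L'\in\mathscr{L}\setminus\mathcal{C}$. The optimality set of an estimator $\delta$ is $\mathscr{L}(\delta)=\{L\in\mathscr{L}:\delta\in\mathcal{O}(L)\}$. An exclusivity class for $\delta$ is a maximal (with respect to inclusion) exclusivity region $\mathcal{C}\subseteq\mathscr{L}$ such that $\mathcal{C}\subseteq\mathscr{L}(\delta)$; thus the losses in an exclusivity class admit a common optimal estimator. A class is realizable if it contains a loss $L$ with $\mathcal{O}(L)\neq\emptyset$.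
   Formalization: ''Meets uncountably many classes'' is stated for families of realizable exclusivity classes covering the segment: if the convex space also contains the zero loss, as for conv{0, a², (a−1)²} on [0,1], no realizable class exists. The parenthetical cautions are not formalized. *)

(* Defs.v *)
From HB Require Import structures.
From mathcomp Require Import all_boot all_order all_algebra.
From mathcomp Require Import all_classical all_reals all_analysis.

Set Implicit Arguments.
Unset Strict Implicit.
Unset Printing Implicit Defensive.

Import Order.TTheory GRing.Theory Num.Theory.
Import numFieldNormedType.Exports.

Local Open Scope classical_set_scope.
Local Open Scope ring_scope.

Definition finite_dimensional (R : realType) (V : normedModType R) : Prop :=
  exists (n : nat) (e : 'I_n -> V),
    forall v : V, exists c : 'I_n -> R, v = \sum_(i < n) c i *: e i.

(* Losses live on the action set itself, the subtype [set_type A] of [V] with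
   the topology induced by [V], so that two losses are equal as soon as they
   agree on Theta x A. The codomain is [R^o], which is [R] seen as a module over
   itself, so that losses form an [lmodType]. *)
Section losses.
Context {R : realType} {V : normedModType R} (A : set V).
Context {d : measure_display} (T : measurableType d).

Definition loss_fun : Type := T -> set_type A -> R^o.

(* Product of the sigma-algebra of [T] and of the Borel sigma-algebra of [A];
   [set_type A] is not a [pointedType], so the library's [measurableType] on
   products does not apply to [T * A]. *)
Definition product_sigma_algebra : set (set (T * set_type A)) :=
  <<s [set M `*` U | M in @measurable d T & U in @open (set_type A)] >>.

Definition is_loss (L : loss_fun) : Prop :=
  [/\ forall t a, 0 <= L t a,
      forall Y : set R, measurable Y ->
        product_sigma_algebra [set x | Y (L x.1 x.2)]
    & forall t, continuous (L t)].

Definition bayes_risk (P : probability T R) (L : loss_fun) (a : set_type A) :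
    \bar R :=
  'E_P[fun t => L t a].

Definition bayes_acts (P : probability T R) (L : loss_fun) :
    set (set_type A) :=
  [set a | forall b, (bayes_risk P L a <= bayes_risk P L b)%E].

Definition mixture (L0 L1 : loss_fun) (alpha : R) : loss_fun :=
  (1 - alpha) *: L0 + alpha *: L1.

End losses.

Section functionals.
Context {R : realType} {V : normedModType R} {A : set V}.
Implicit Type f : set_type A -> \bar R.

Definition proper_functional f : Prop :=
  (forall a, (-oo < f a)%E) /\ (exists a, (f a < +oo)%E).

Definition coercive f : Prop :=
  forall M : R, exists r : R,
    forall a, r < `|\val a| -> (M%:E < f a)%E.

(* The inequality is required between points of the effective domain, as usual
   for extended real-valued functionals; [z] is the point of [A] whose
   underlying vector is the convex combination. *)
Definition strictly_convex f : Prop :=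
  forall (x y z : set_type A) (t : R),
    (f x < +oo)%E -> (f y < +oo)%E -> x <> y -> 0 < t -> t < 1 ->
    \val z = (1 - t) *: \val x + t *: \val y ->
    (f z < (1 - t)%:E * f x + t%:E * f y)%E.

End functionals.

Section exclusivity.
Context {LT E : Type} (Ls : set LT) (O : LT -> set E).

Definition exclusivity_region (C : set LT) : Prop :=
  C `<=` Ls /\
  forall delta : E,
    ~ ((exists2 L, C L & O L delta) /\
       (exists2 L', (Ls `\` C) L' & O L' delta)).

Definition optimality_set (delta : E) : set LT :=
  [set L | Ls L /\ O L delta].

Definition exclusivity_class_for (delta : E) (C : set LT) : Prop :=
  [/\ exclusivity_region C,
      C `<=` optimality_set delta
    & forall C', exclusivity_region C' -> C' `<=` optimality_set delta ->
        C `<=` C' -> C' = C].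

Definition realizable (C : set LT) : Prop := exists2 L, C L & O L !=set0.

Definition realizable_exclusivity_class (C : set LT) : Prop :=
  (exists delta, exclusivity_class_for delta C) /\ realizable C.

End exclusivity.

Definition family_total_on {LT : Type} (F : set (set LT)) (S : set LT) : Prop :=
  S `<=` \bigcup_(C in F) C.

(* Main.v *)
(* The minimizer a*(alpha) of B_alpha depends continuously on alpha, so
   alpha |-> |a*(alpha) - a*(0)| takes, by the intermediate value theorem, every
   value between 0 and |a1 - a0| > 0, and uncountably many Bayes acts occur. All
   losses of an exclusivity class share an optimal act, so a class containing
   L_alpha determines a*(alpha), and countably many classes reach only countably
   many Bayes acts. *)
Require Import Defs.
From HB Require Import structures.
From mathcomp Require Import all_boot all_order all_algebra.
From mathcomp Require Import all_classical all_reals all_analysis.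

Set Implicit Arguments.
Unset Strict Implicit.
Unset Printing Implicit Defensive.

Import Order.TTheory GRing.Theory Num.Theory.
Import numFieldNormedType.Exports.

Local Open Scope classical_set_scope.
Local Open Scope ring_scope.

(** * Bases and compactness in finite dimension *)

(** A spanning family of least length is free: a nontrivial relation would express one vector
    through the others and leave a shorter spanning family. *)
Lemma finite_dimensional_basis (R : realType) (V : normedModType R) :
  finite_dimensional V ->
  exists (n : nat) (e : 'I_n -> V),
    (forall v, exists c : 'rV[R]_n, v = \sum_(i < n) c ord0 i *: e i) /\
    (forall c : 'rV[R]_n, \sum_(i < n) c ord0 i *: e i = 0 -> c = 0).
Proof.
move=> [n0 [e0 e0P]].
pose spans n := exists e : 'I_n -> V,
  forall v, exists c : 'rV[R]_n, v = \sum_(i < n) c ord0 i *: e i.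
have ex_spans : exists n, `[< spans n >].
  exists n0; apply/asboolP; exists e0 => v; have [c ->] := e0P v.
  by exists (\row_i c i); apply: eq_bigr => i _; rewrite mxE.
case: (ex_minnP ex_spans) => n /asboolP [e eP] n_min.
exists n, e; split=> // c c0; apply/eqP/negPn/negP => /eqP cN0.
have [j cjN0] : exists j, c ord0 j != 0.
  apply: contrapT => /forallNP cj0; apply: cN0; apply/rowP => j.
  by rewrite mxE; apply/eqP/negPn/negP/cj0.
case: n j e eP n_min c c0 cN0 cjN0 => [[]//|n] j e eP n_min c c0 _ cjN0.
suff /asboolP/n_min : spans n by rewrite ltnn.
exists (fun i => e (lift j i)) => v; have [b ->] := eP v.
have ej : e j = \sum_i - (c ord0 j)^-1 * c ord0 (lift j i) *: e (lift j i).
  move: c0; rewrite (bigD1_ord j)//= => /eqP; rewrite addr_eq0 => /eqP cej.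
  rewrite -[LHS]scale1r -(mulVf cjN0) -scalerA cej scalerN scaler_sumr.
  by rewrite -sumrN; apply: eq_bigr => i _; rewrite mulNr scaleNr scalerA.
exists (\row_i (b ord0 (lift j i) +
                b ord0 j * (- (c ord0 j)^-1 * c ord0 (lift j i)))).
rewrite (bigD1_ord j)//= [in LHS]ej scaler_sumr -big_split/=.
by apply: eq_bigr => i _; rewrite mxE scalerDl addrC scalerA.
Qed.

(* Coordinates in a basis are bounded: the norm of [V] is continuous and does
   not vanish on the unit sphere of ['rV[R]_n], hence is bounded below there. *)
Lemma finite_dimensional_compact (R : realType) (V : normedModType R)
    (K : set V) (r : R) :
  finite_dimensional V -> closed K -> (forall v, K v -> `|v| <= r) -> compact K.
Proof.
move=> /finite_dimensional_basis [n [e [eP e_free]]] Kcl Kr.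
pose phi (c : 'rV[R]_n) : V := \sum_(i < n) c ord0 i *: e i.
have phi_cont : continuous phi.
  apply: continuous_big => [|i _ c]; first exact: add_continuous.
  by apply: continuousZr_tmp; exact: coord_continuous.
pose S := [set c : 'rV[R]_n | `|c| = 1].
have Scompact : compact S.
  apply: bounded_closed_compact.
    by exists 1; split=> // x x1 c /= ->; exact: ltW.
  apply: (@preimage_closed _ _ (Num.norm : 'rV[R]_n -> R) [set 1]);
    last exact: closed_eq.
  by move=> c _; exact: norm_continuous.
have [m m_gt0 phi_ge] : exists2 m, 0 < m & forall c, m * `|c| <= `|phi c|.
  have phi_scale a c : phi (a *: c) = a *: phi c.
    by rewrite /phi scaler_sumr; apply: eq_bigr => i _; rewrite mxE scalerA.
  have normed_S c : c != 0 -> S (`|c|^-1 *: c).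
    by move=> cN0; rewrite /S/= normrZ normfV normr_id mulVf ?normr_eq0.
  (* If the sphere is empty (dimension zero), every [c] is 0 and any positive [m] will do. *)
  have [[c0 Sc0]|S0] := pselect (S !=set0); last first.
    exists 1 => // c; have [->|/normed_S Sc] := eqVneq c 0.
      by rewrite normr0 mulr0.
    by case: S0; eexists; exact: Sc.
  have [||c /set_mem Sc c_min] :=
    @compact_EVT_min _ _ (fun c => `|phi c|) S _ Scompact.
  - by exists c0.
  - apply: continuous_subspaceT => c.
    apply: (@continuous_comp _ _ _ phi); first exact: phi_cont.
    exact: norm_continuous.
  exists `|phi c|.
    rewrite normr_gt0; apply/eqP => /e_free c_eq0.
    by move: Sc; rewrite /S/= c_eq0 normr0 => /esym/eqP; rewrite oner_eq0.
  move=> b; have [->|bN0] := eqVneq b 0; first by rewrite normr0 mulr0.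
  have := c_min _ (mem_set (normed_S _ bN0)).
  by rewrite phi_scale normrZ normfV normr_id ler_pdivlMl ?normr_gt0// mulrC.
have -> : K = phi @` (phi @^-1` K).
  rewrite image_preimage//; apply/seteqP; split=> // v _.
  by have [c ->] := eP v; exists c.
apply: continuous_compact; first exact: continuous_subspaceT.
apply: bounded_closed_compact.
  exists (r / m); split; first exact: num_real.
  move=> x rx c Kc; apply: ltW; apply: le_lt_trans rx.
  by rewrite ler_pdivlMr// mulrC (le_trans (phi_ge _))// Kr.
by apply: preimage_closed => // c _; exact: phi_cont.
Qed.

(** A filter on the subtype is pushed forward to [X], where it clusters in [K] and, [A] being
    closed, in [A]. Open sets of the subtype are traces of open sets of [X], so the cluster point
    lifts back. *)
Lemma compact_set_val (X : topologicalType) (A K : set X) :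
  closed A -> compact K -> compact (set_val @^-1` K : set (set_type A)).
Proof.
move=> Acl Kcpt F FF FK.
have GF : ProperFilter (set_val @ F : set_system X).
  exact: fmap_proper_filter.
have GKA : (set_val @ F) (K `&` A).
  rewrite /fmap/= /nbhs/=; apply: filterS FK => a Ka; split => //.
  exact: set_valP.
have [x [[Kx Ax] Fx]] := compact_closedI Kcpt Acl GF GKA.
exists (SigSub (mem_set Ax)); split=> // U W FU [] _ [[D oD <-] Dx DW].
have [_ [[a Ua <-] Da]] : (set_val @` U) `&` D !=set0.
  apply: Fx; last exact: open_nbhs_nbhs.
  by rewrite /fmap/= /nbhs/=; apply: filterS FU => a Ua; exists a.
by exists a; split=> //; exact: DW.
Qed.

(** * Minima of lower semicontinuous functions *)

Lemma ereal_dense (R : realType) (x y : \bar R) :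
  (x < y)%E -> exists2 r : R, (x < r%:E)%E & (r%:E < y)%E.
Proof.
case: x y => [a||] [b||] //= ab.
- by exists ((a + b) / 2); rewrite lte_fin midf_lt.
- by exists (a + 1); rewrite ?ltry// lte_fin ltrDl.
- by exists (b - 1); rewrite ?ltNyr// lte_fin ltrBlDr ltrDl.
- by exists 0; rewrite ?ltNyr ?ltry.
Qed.

(** The sublevel sets of [f] in [K] at the values [f k] are nested, hence form a filter base, and
    any cluster point [c] is a minimizer: if [f k < a < f c], some neighbourhood of [c] has [f > a]
    and misses the sublevel set of [k]. *)
Lemma compact_lower_semicontinuous_min (X : topologicalType) (R : realType)
    (f : X -> \bar R) (K : set X) :
  K !=set0 -> compact K -> lower_semicontinuous f ->
  exists2 c, K c & forall x, K x -> (f c <= f x)%E.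
Proof.
move=> K0 Kcpt f_lsc.
pose G := filter_from K (fun k => K `&` [set x | (f x <= f k)%E]).
have GF : ProperFilter G.
  apply: filter_from_proper => [|k Kk]; last by exists k; split => /=.
  apply: filter_from_filter => // i j Ki Kj.
  have [fij|/ltW fji] := leP (f i) (f j).
    by exists i => // x [Kx /= xi]; do !split => //=; exact: le_trans fij.
  by exists j => // x [Kx /= xj]; do !split => //=; exact: le_trans fji.
have GK : G K by case: K0 => k Kk; exists k => // x [].
have [c [Kc Gc]] := Kcpt G GF GK.
exists c => // k Kk; rewrite leNgt; apply/negP => fkc.
have [a fka afc] := ereal_dense fkc.
have [V cV aV] := f_lsc c a afc.
have [x [[Kx /= fxk] /aV]] : (K `&` [set x | (f x <= f k)%E]) `&` V !=set0.
  by apply: Gc => //; exists k.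
by rewrite ltNge (le_trans fxk (ltW fka)).
Qed.

(** * Existence, uniqueness and continuity of minimizers *)

Section minimizers.
Context {R : realType} {V : normedModType R} {A : set V}.
Implicit Types (f : set_type A -> \bar R) (x y z : set_type A).

Lemma convex_set_segment x y (t : R) :
  convex_set A -> 0 <= t <= 1 ->
  exists z, \val z = (1 - t) *: \val x + t *: \val y.
Proof.
move=> Aconv /andP[t0 t1].
have := Aconv _ _ (Itv01 t0 t1) (valP y) (valP x) => Az.
by exists (SigSub Az); rewrite /= addrC.
Qed.

Lemma strictly_convex_lt f x y z (t : R) :
  proper_functional f -> strictly_convex f ->
  (f y <= f x)%E -> (f x < +oo)%E -> x <> y -> 0 < t < 1 ->
  \val z = (1 - t) *: \val x + t *: \val y -> (f z < f x)%E.
Proof.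
move=> [f_gtNy _] f_conv yx x_fin xNy /andP[t0 t1] z_eq.
have fx : f x \is a fin_num by rewrite fin_numE gt_eqF// lt_eqF.
have y_fin := le_lt_trans yx x_fin.
apply: (lt_le_trans (f_conv _ _ _ _ x_fin y_fin xNy t0 t1 z_eq)).
apply: (@le_trans _ _ ((1 - t)%:E * f x + t%:E * f x)%E).
  by rewrite leeD2l// lee_pmul2l// lte_fin.
by rewrite -muleDl// -EFinD subrK mul1e.
Qed.

(** Coercivity at the level of a finite value [f a] confines the search to a closed ball, compact
    within [A]; the midpoint of two distinct minimizers would have a strictly smaller value. *)
Lemma unique_minimizer f :
  finite_dimensional V -> closed A -> convex_set A ->
  proper_functional f -> lower_semicontinuous f -> coercive f ->
  strictly_convex f ->
  exists a, [set a | forall b, (f a <= f b)%E] = [set a].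
Proof.
move=> Vfin Acl Aconv f_proper f_lsc f_coer f_conv.
have [f_gtNy [a fa]] := f_proper.
have [r rP] := f_coer (fine (f a)).
have fa_fin : f a \is a fin_num by rewrite fin_numE gt_eqF// lt_eqF.
pose K : set (set_type A) := set_val @^-1` [set v | `|v| <= r].
have Ka : K a.
  by rewrite /K/= leNgt; apply/negP => /rP; rewrite fineK// ltxx.
have Kcpt : compact K.
  apply: compact_set_val => //.
  apply: (@finite_dimensional_compact _ _ _ r) => //.
  apply: (@preimage_closed _ _ (Num.norm : V -> R) [set t | t <= r]).
    by move=> v _; exact: norm_continuous.
  exact: closed_le.
have [c Kc c_min] :=
  compact_lower_semicontinuous_min (ex_intro _ a Ka) Kcpt f_lsc.
have {}c_min b : (f c <= f b)%E.
  have [/c_min//|] := pselect (K b).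
  rewrite /K/= => /negP; rewrite -ltNge => /rP; rewrite fineK// => /ltW.
  by apply: le_trans; exact: c_min.
exists c; apply/seteqP; split => [b b_min /=|_ -> //].
apply: contrapT => bc.
have half : 0 < (2^-1 : R) < 1 by rewrite invr_gt0 ltr0n invf_lt1 ?ltr1n.
have [|z z_eq] := @convex_set_segment b c 2^-1 Aconv.
  by case/andP: half => /ltW -> /ltW ->.
have fb : (f b < +oo)%E by exact: le_lt_trans fa.
have := strictly_convex_lt f_proper f_conv (c_min b) fb bc half z_eq.
by rewrite ltNge b_min.
Qed.

(* On the sphere of radius [eps] around the minimizer of [B p0], the value of
   [B p0] exceeds its minimum; by compactness this persists for [p] near [p0],
   and convexity then traps the minimizer of [B p] inside the sphere. *)
Lemma minimizer_continuous (P : topologicalType) (D : set P)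
    (B : P -> set_type A -> \bar R) (xmin : P -> set_type A) :
  finite_dimensional V -> closed A -> convex_set A ->
  (forall p, D p -> proper_functional (B p)) ->
  (forall p, D p -> strictly_convex (B p)) ->
  (forall p, D p -> [set a | forall b, (B p a <= B p b)%E] = [set xmin p]) ->
  {within D `*` setT, continuous (fun q => B q.1 q.2)} ->
  {within D, continuous (fun p => \val (xmin p))}.
Proof.
move=> Vfin Acl Aconv B_proper B_conv xminP /subspace_continuousP B_cont.
have xmin_le p b : D p -> (B p (xmin p) <= B p b)%E.
  by move=> /xminP/seteqP[_ /(_ (xmin p) erefl)]; exact.
apply/subspace_continuousP => p0 Dp0; apply/cvgrPdist_lt => eps eps0.
pose S : set (set_type A) :=
  set_val @^-1` [set v | `|\val (xmin p0) - v| = eps].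
have Scpt : compact S.
  apply: compact_set_val => //.
  apply: (@finite_dimensional_compact _ _ _ (`|\val (xmin p0)| + eps)) => //.
    apply: (@preimage_closed _ _ (fun v : V => `|\val (xmin p0) - v|)
      [set eps]); last exact: closed_eq.
    move=> v _; apply: (@continuous_comp _ _ _ (fun v => \val (xmin p0) - v));
      last exact: norm_continuous.
    by apply: continuousB => //; exact: cst_continuous.
  move=> v /= v_eps; rewrite -[v](subKr (\val (xmin p0))).
  by rewrite (le_trans (ler_normB _ _))// v_eps.
have B_near a (Q : set (\bar R)) : nbhs (B p0 a) Q ->
    \forall a' \near a & p \near within D (nbhs p0), Q (B p a').
  move=> /(B_cont (p0, a) (conj Dp0 I)) [[U W] /= [Up0 Wa] UWQ].
  exists (W, D `&` U).
    by split=> //; apply: filterS Up0 => p Up Dp.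
  by move=> [a' p] /= [Wa' [Dp Up]]; exact: (UWQ (p, a')).
have S_gt : \forall p \near within D (nbhs p0),
    S `<=` (fun a => B p (xmin p0) < B p a)%E.
  (* The near-covering form of compactness reduces a neighbourhood of [p0] uniform over [S] to one
     depending on the point [a] of [S]. *)
  move/compact_near_coveringP: Scpt; apply => a Sa.
  have B_lt : (B p0 (xmin p0) < B p0 a)%E.
    rewrite lt_neqAle xmin_le// andbT; apply/eqP => B_eq.
    have /seteqP[/(_ a) a_min _] := xminP _ Dp0.
    have aE : a = xmin p0 by apply: a_min => b; rewrite -B_eq xmin_le.
    by have := eps0; rewrite -Sa aE subrr normr0 ltxx.
  (* The level [m] separates the two values at [p0]; by joint continuity each stays on its side of
     [m] nearby. *)
  have [m /open_ereal_lt' xmin_lt /open_ereal_gt' lt_a] := ereal_dense B_lt.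
  have [[W1 U1] /= [/nbhs_singleton W1x U1p0] B_lt_m] := B_near _ _ xmin_lt.
  have [[W2 U2] /= [W2a U2p0] m_lt_B] := B_near _ _ lt_a.
  exists (W2, U1 `&` U2); first by split=> //; exact: filterI.
  move=> [a' p] /= [W2a' [U1p U2p]].
  exact: lt_trans (B_lt_m (_, p) _) (m_lt_B (a', p) _).
near=> p.
have Dp : D p by near: p; exact: withinT.
have Sp_gt : S `<=` (fun a => B p (xmin p0) < B p a)%E by near: p; exact: S_gt.
rewrite ltNge le_eqVlt; apply/negP => /predU1P[eps_eq|eps_lt].
  by have := Sp_gt (xmin p) (esym eps_eq); rewrite ltNge xmin_le.
pose dist := `|\val (xmin p0) - \val (xmin p)|.
have dist0 : 0 < dist by exact: lt_trans eps_lt.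
have t01 : 0 < eps / dist < 1 by rewrite divr_gt0//= ltr_pdivrMr// mul1r.
(* The fraction [eps / dist] places [z] at distance [eps] from [xmin p0], where the segment crosses
   the sphere. *)
have [|z z_eq] := @convex_set_segment (xmin p0) (xmin p) (eps / dist) Aconv.
  by case/andP: t01 => /ltW -> /ltW ->.
have Sz : S z.
  rewrite /S/= set_valE/= z_eq scalerBl scale1r opprD opprB.
  rewrite addrA addrCA subrr addr0.
  by rewrite -scalerBr normrZ gtr0_norm ?divr_gt0// divfK// gt_eqF.
have B_z := Sp_gt _ Sz.
have x_neq : xmin p0 <> xmin p.
  by move=> xE; move: dist0; rewrite /dist xE subrr normr0 ltxx.
(* [B p (xmin p0)] is finite because it lies strictly below [B p z]. *)
have := strictly_convex_lt (B_proper _ Dp) (B_conv _ Dp) (xmin_le _ _ Dp)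
  (lt_le_trans B_z (leey _)) x_neq t01 z_eq.
by rewrite ltNge (ltW B_z).
Unshelve. all: by end_near. Qed.

End minimizers.

(** * From continuity to uncountably many classes *)

(** The distance to [f a] maps the image onto a set containing an interval of positive length, which
    has positive Lebesgue measure, whereas countable sets are null. *)
Lemma uncountable_continuous_image (R : realType) (V : normedModType R)
    (f : R -> V) (a b : R) :
  a <= b -> {within `[a, b], continuous f} -> f a <> f b ->
  ~ countable (f @` `[a, b]).
Proof.
move=> ab f_cont fab f_count.
pose g x := `|f x - f a|.
have g_cont : {within `[a, b], continuous g}.
  move=> x; apply: (@continuous_comp (subspace _) _ _ f (fun v => `|v - f a|)).
    exact: f_cont.
  apply: (@continuous_comp _ _ _ (fun v => v - f a));
    last exact: norm_continuous.
  by apply: continuousB => //; exact: cst_continuous.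
have ga : g a = 0 by rewrite /g subrr normr0.
have gb : 0 < g b by rewrite normr_gt0 subr_eq0; apply/eqP => /esym.
have : countable (`[0, g b]%classic : set R).
  apply: (sub_countable _ f_count).
  apply: (card_le_trans _ (card_image_le (fun v => `|v - f a|) _)).
  apply: subset_card_le => y /=; rewrite in_itv/= => y_itv.
  have [|c c_itv gcy] := IVT ab g_cont (v := y).
    by rewrite ga (min_idPl (ltW gb)) (max_idPr (ltW gb)).
  by exists (f c) => //; exists c.
move/countable_lebesgue_measure0; rewrite lebesgue_measure_itv/= lte_fin gb.
by move=> /eqP; rewrite oppr0 adde0 eqe gt_eqF.
Qed.

(** The estimator that defines the class is optimal for every loss in it, in particular for [L], so
    it must be [delta]. *)
Lemma exclusivity_class_act (LT E : Type) (Ls : set LT) (O : LT -> set E)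
    (C : set LT) (L : LT) (delta : E) :
  realizable_exclusivity_class Ls O C -> C L -> O L = [set delta] ->
  forall L', C L' -> O L' delta.
Proof.
move=> [[delta' [_ C_opt _]] _] CL OL L' /C_opt[_].
by have [_] := C_opt _ CL; rewrite OL => ->.
Qed.

Section mixtures.
Context {R : realType} {V : normedModType R} (A : set V).
Context {d : measure_display} (T : measurableType d) (L0 L1 : loss_fun A T).

Lemma mixture0 : mixture L0 L1 0 = L0.
Proof. by rewrite /mixture subr0 scale1r scale0r addr0. Qed.

Lemma mixture1 : mixture L0 L1 1 = L1.
Proof. by rewrite /mixture subrr scale0r scale1r add0r. Qed.

End mixtures.

Theorem theorem4 (R : realType) (V : normedModType R) (A : set V)
  (d : measure_display) (T : measurableType d) (P : probability T R)
  (Ls : set (loss_fun A T)) (L0 L1 : loss_fun A T) (a0 a1 : set_type A)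
  (hV : finite_dimensional V)
  (hA0 : A !=set0) (hAclosed : closed A) (hAconvex : convex_set A)
  (hLs : Ls `<=` @is_loss R V A d T)
  (hL0 : Ls L0) (hL1 : Ls L1)
  (hi : @convex_set R (loss_fun A T) Ls)
  (hii : forall alpha : R, 0 <= alpha <= 1 ->
     let B := bayes_risk P (mixture L0 L1 alpha) in
     [/\ proper_functional B, lower_semicontinuous B, coercive B & strictly_convex B])
  (hiii : {within `[0, 1] `*` [set: set_type A], continuous
     (fun x : R * set_type A => bayes_risk P (mixture L0 L1 x.1) x.2)})
  (ha0 : bayes_acts P L0 a0) (ha1 : bayes_acts P L1 a1)
  (hiv : a0 <> a1) :
  let O := @bayes_acts R V A d T P in
  let segment := [set mixture L0 L1 alpha | alpha in `[0, 1]] in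
  exists astar : R -> set_type A,
    [/\ forall alpha : R, 0 <= alpha <= 1 ->
          O (mixture L0 L1 alpha) = [set astar alpha],
        ~ countable [set astar alpha | alpha in `[0, 1]],
        forall (C C' : set (loss_fun A T)) (alpha beta : R),
          realizable_exclusivity_class Ls O C ->
          realizable_exclusivity_class Ls O C' ->
          0 <= alpha <= 1 -> 0 <= beta <= 1 ->
          C (mixture L0 L1 alpha) -> C' (mixture L0 L1 beta) ->
          astar alpha <> astar beta -> C <> C',
        forall F : set (set (loss_fun A T)),
          F `<=` realizable_exclusivity_class Ls O ->
          family_total_on F segment ->
          ~ countable F /\ ~ countable [set C | F C /\ C `&` segment !=set0]
      & ~ exists F : set (set (loss_fun A T)),
          [/\ finite_set F, F `<=` realizable_exclusivity_class Ls O
            & family_total_on F segment]].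
Proof.
move=> O segment.
pose B alpha := bayes_risk P (mixture L0 L1 alpha).
(* Outside the unit interval [a0] is a mere default that makes [astar] total. *)
have /choice [astar astarP] (alpha : R) : exists a : set_type A,
    0 <= alpha <= 1 -> O (mixture L0 L1 alpha) = [set a].
  have [alpha01|] := boolP (0 <= alpha <= 1); last by exists a0.
  have [B_proper B_lsc B_coer B_conv] := hii alpha alpha01.
  have [a aE] :=
    unique_minimizer hV hAclosed hAconvex B_proper B_lsc B_coer B_conv.
  by exists a.
have act_eq (C : set (loss_fun A T)) alpha beta :
    realizable_exclusivity_class Ls O C ->
    0 <= alpha <= 1 -> 0 <= beta <= 1 ->
    C (mixture L0 L1 alpha) -> C (mixture L0 L1 beta) ->
    astar alpha = astar beta.
  move=> C_class alpha01 beta01 Calpha Cbeta.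
  have := exclusivity_class_act C_class Calpha (astarP _ alpha01) Cbeta.
  by rewrite astarP.
have astar_uncountable : ~ countable [set astar alpha | alpha in `[0, 1]].
  have val_cont :
      {within `[0, 1], continuous (fun alpha => \val (astar alpha))}.
    apply: (minimizer_continuous (B := B)) => // alpha.
    - by rewrite /= in_itv/= => /hii[].
    - by rewrite /= in_itv/= => /hii[].
  have val_neq : \val (astar 0) <> \val (astar 1).
    move=> /val_inj astar_eq; apply: hiv.
    have act i a : 0 <= i <= 1 -> O (mixture L0 L1 i) a -> a = astar i.
      by move=> /astarP ->.
    have -> : a0 = astar 0 by apply: act; rewrite ?lexx ?ler01 ?mixture0.
    by have -> : a1 = astar 1 by apply: act; rewrite ?lexx ?ler01 ?mixture1.
  move=> astar_count.
  apply: (uncountable_continuous_image ler01 val_cont val_neq).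
  rewrite -(image_comp astar (fun a => \val a)).
  exact: sub_countable (card_image_le _ _) astar_count.
have cover_uncountable (F : set (set (loss_fun A T))) :
    F `<=` realizable_exclusivity_class Ls O -> family_total_on F segment ->
    ~ countable [set C | F C /\ C `&` segment !=set0].
  move=> F_class F_total F_count; apply: astar_uncountable.
  (* By [act_eq] the mixtures in one class share their act, so the choice made by [xget] is
     immaterial; [a0] is the value on classes that miss the segment. For a total family, [act_of]
     reaches every [astar alpha]. *)
  pose act_of (C : set (loss_fun A T)) : set_type A :=
    xget a0 [set astar alpha | alpha in
               [set alpha | 0 <= alpha <= 1 /\ C (mixture L0 L1 alpha)]].
  apply: sub_countable F_count; apply: card_le_trans (card_image_le act_of _).
  apply: subset_card_le => _ /= [alpha + <-]; rewrite in_itv/= => alpha01.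
  have seg_alpha : segment (mixture L0 L1 alpha).
    by exists alpha => //=; rewrite in_itv.
  have [C FC Calpha] := F_total _ seg_alpha.
  exists C; first by split=> //; exists (mixture L0 L1 alpha).
  rewrite /act_of.
  case: xgetP => [_ _ [beta [beta01 Cbeta] <-]|/(_ (astar alpha)) []].
    exact: act_eq (F_class _ FC) beta01 alpha01 Cbeta Calpha.
  by exists alpha.
exists astar; split => //.
- move=> C C' alpha beta C_class _ alpha01 beta01 Calpha + astar_neq CC'.
  by rewrite -CC' => Cbeta; apply: astar_neq; exact: act_eq C_class _ _ _ _.
- move=> F F_class F_total; have F_unc := cover_uncountable F F_class F_total.
  split=> // F_count; apply: F_unc.
  by apply: sub_countable F_count; apply: subset_card_le => C [].
- move=> [F [F_fin F_class F_total]]; apply: (cover_uncountable F) => //.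
  apply: sub_countable (finite_set_countable F_fin).
  by apply: subset_card_le => C [].
Qed.
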